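(* Let $D$ be an integral domain and let $R$ be a retract $D$-algebra. Then: (a) the canonical map $\iota:\mathrm{Pic}(D)\to\mathrm{Pic}(R)$ is injective; (b) $\iota(\mathrm{Pic}(D))$ is a direct summand of $\mathrm{Pic}(R)$ and of $\mathrm{Pic}_u(R,D)$; (c) $\mathrm{Pic}(R)\simeq\mathrm{Pic}(D)\oplus\mathrm{LPic}(R,D)$; (d) $\mathrm{Pic}_u(R,D)\simeq\mathrm{Pic}(D)\oplus\mathrm{LPic}_u(R,D)$.
   Context: All rings are commutative with unit; $D$ is an integral domain that is not a field, with quotient field $K$. A retract $D$-algebra is a $D$-algebra $R$ that is an integral domain and admits a $D$-algebra homomorphism $\epsilon:R\to D$ (then $D\subseteq R$, and $K$ is viewed inside the quotient field of $R$). $\mathrm{Pic}(R)$ is the group of invertible fractional ideals of $R$ modulo nonzero principal fractional ideals, and $\iota([I])=[IR]$. A fractional ideal $I$ of $R$ is integral if $I\subseteq R$, and unitary with respect to $D$ if $I\cap K\neq(0)$. $\mathrm{Pic}_u(R,D)$ is the subgroup of $\mathrm{Pic}(R)$ generated by the classes of the invertible ideals of $R$ that are both integral and unitary with respect to $D$; it contains $\iota(\mathrm{Pic}(D))$. $\mathrm{LPic}(R,D):=\mathrm{Pic}(R)/\iota(\mathrm{Pic}(D))$ and $\mathrm{LPic}_u(R,D):=\mathrm{Pic}_u(R,D)/\iota(\mathrm{Pic}(D))$. *)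

(* Defs.v *)
From HB Require Import structures.
From mathcomp Require Import all_boot all_algebra.
From mathcomp Require Import generic_quotient ring_quotient fraction.
From mathcomp Require Import boolp classical_sets.

Set Implicit Arguments.
Unset Strict Implicit.
Unset Printing Implicit Defensive.

Import GRing.Theory.
Local Open Scope ring_scope.
Local Open Scope classical_set_scope.
Local Open Scope quotient_scope.

Notation "x %:F" := (@FracField.tofrac _ x) (at level 1, format "x %:F").

Section FractionalIdeals.
Variable R : idomainType.
Local Notation Q := {fraction R}.
Implicit Types (I J L A : set Q) (x y z : Q) (r : R).

Definition base_ring : set Q := range (@FracField.tofrac R).

Definition submodule I : Prop :=
  [/\ I 0, forall x y, I x -> I y -> I (x + y)
    & forall r x, I x -> I (r%:F * x)].

Definition Rspan A : set Q := smallest submodule A.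

Definition fractional I : Prop :=
  submodule I /\
  exists2 d : R, d != 0 & forall x, I x -> base_ring (d%:F * x).

Definition idealM I J : set Q := Rspan [set x * y | x in I & y in J].

Definition invertible I : Prop :=
  fractional I /\ exists2 J, fractional J & idealM I J = base_ring.

Definition principal_ideal x : set Q := [set r%:F * x | r in setT].

(* (R : I); it is the inverse of I when I is invertible (inverse_idealV). *)
Definition idealV I : set Q := [set x | forall y, I y -> base_ring (x * y)].

Lemma submodule_base_ring : submodule base_ring.
Proof.
split; first by exists 0 => //; rewrite rmorph0.
  by move=> _ _ [a _ <-] [b _ <-]; exists (a + b) => //; rewrite rmorphD.
by move=> r _ [a _ <-]; exists (r * a) => //; rewrite rmorphM.
Qed.

Lemma submodule_Rspan A : submodule (Rspan A).
Proof.
split; first by move=> M [[]].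
- move=> x y Ax Ay M MA; have [[_ MD _] _] := MA.
  by apply: MD; [exact: (Ax M MA) | exact: (Ay M MA)].
- by move=> r x Ax M MA; have [[_ _ MZ] _] := MA; exact: MZ (Ax M MA).
Qed.

Lemma Rspan_sub A L : submodule L -> (Rspan A `<=` L) <-> (A `<=` L).
Proof.
move=> sL; split=> AL; last exact: (smallest_sub sL AL).
by apply: subset_trans AL; apply: sub_gen_smallest.
Qed.

Lemma idealM_sub I J L : submodule L ->
  (idealM I J `<=` L) <-> (forall x y, I x -> J y -> L (x * y)).
Proof.
move=> sL; rewrite /idealM Rspan_sub //; split=> [h x y Ix Jy|h _ [x Ix [y Jy <-]]].
  by apply: h; exists x => //; exists y.
exact: h.
Qed.

Lemma submodule_idealM I J : submodule (idealM I J).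
Proof. exact: submodule_Rspan. Qed.

Lemma mem_idealM I J x y : I x -> J y -> idealM I J (x * y).
Proof. by move: x y; apply/idealM_sub => //; apply: submodule_Rspan. Qed.

Lemma submodule_divr L y : submodule L -> submodule [set x | L (x * y)].
Proof.
move=> [L0 LD LZ]; split=> /=; first by rewrite mul0r.
  by move=> u v Lu Lv; rewrite mulrDl; apply: LD.
by move=> r u Lu; rewrite -mulrA; apply: LZ.
Qed.

Lemma idealMC : commutative idealM.
Proof.
move=> I J; rewrite eqEsubset; split; apply/idealM_sub => [|x y ? ?];
  by [apply: submodule_Rspan | rewrite mulrC; apply: mem_idealM].
Qed.

Lemma idealM3_sub I J L M : submodule M -> (idealM (idealM I J) L `<=` M) <->
  (forall x y z, I x -> J y -> L z -> M (x * y * z)).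
Proof.
move=> sM; rewrite idealM_sub //; split=> [h x y z Ix Jy Lz|h x z IJx Lz].
  by apply: h => //; apply: mem_idealM.
have sMz := submodule_divr z sM.
suff : idealM I J `<=` [set x | M (x * z)] by apply.
by apply/idealM_sub => //= u v Iu Jv; apply: h.
Qed.

Lemma idealMA : associative idealM.
Proof.
move=> I J L; rewrite eqEsubset; split.
  rewrite idealMC [idealM J L]idealMC.
  apply/idealM3_sub => [|x y z Lx Jy Iz]; first exact: submodule_Rspan.
  rewrite -mulrA mulrC [y * z]mulrC.
  by apply: mem_idealM => //; apply: mem_idealM.
apply/idealM3_sub => [|x y z Ix Jy Lz]; first exact: submodule_Rspan.
by rewrite -mulrA; apply: mem_idealM => //; apply: mem_idealM.
Qed.

Lemma base_ring1 : base_ring 1.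
Proof. by exists 1 => //; rewrite rmorph1. Qed.

Lemma ideal1M I : submodule I -> idealM base_ring I = I.
Proof.
move=> sI; rewrite eqEsubset; split.
  by apply/idealM_sub => // _ y [r _ <-] Iy; case: sI => _ _; apply.
by move=> x Ix; rewrite -[x]mul1r; apply: mem_idealM => //; apply: base_ring1.
Qed.

Lemma fractional_base_ring : fractional base_ring.
Proof.
split; first exact: submodule_base_ring.
by exists 1; [exact: oner_neq0 | move=> x; rewrite rmorph1 mul1r].
Qed.

Lemma invertible_base_ring : invertible base_ring.
Proof.
split; first exact: fractional_base_ring.
exists base_ring; first exact: fractional_base_ring.
exact/ideal1M/submodule_base_ring.
Qed.

Lemma fractionalM I J : fractional I -> fractional J -> fractional (idealM I J).
Proof.
move=> [sI [d d0 hd]] [sJ [e e0 he]]; split; first exact: submodule_Rspan.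
exists (d * e); first by rewrite mulf_neq0.
suff : idealM I J `<=` [set x | base_ring (x * (d * e)%:F)].
  by move=> h x /h /=; rewrite mulrC.
apply/idealM_sub => [|x y Ix Jy /=].
  exact/submodule_divr/submodule_base_ring.
have [a _ ax] := hd _ Ix; have [b _ bx] := he _ Jy.
exists (a * b) => //; rewrite !tofracM ax bx.
by rewrite [RHS]mulrC mulrACA.
Qed.

Lemma invertibleM I J : invertible I -> invertible J -> invertible (idealM I J).
Proof.
move=> [fI [I' fI' II']] [fJ [J' fJ' JJ']]; split; first exact: fractionalM.
exists (idealM I' J'); first exact: fractionalM.
rewrite -idealMA [idealM J _]idealMC -idealMA [idealM J' J]idealMC JJ'.
rewrite [idealM I' _]idealMC ideal1M //; by case: fI'.
Qed.

Lemma inverse_idealV I J : fractional J -> idealM I J = base_ring -> J = idealV I.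
Proof.
move=> [sJ fJ] IJ; rewrite eqEsubset; split=> [x Jx y Iy|x hx].
  by rewrite mulrC -IJ; apply: mem_idealM.
have : idealM I J `<=` [set z | J (z * x)].
  apply/idealM_sub => [|u v Iu Jv /=]; first exact: submodule_divr.
  have [r _ rE] := hx _ Iu.
  by rewrite mulrAC [u * x]mulrC -rE; case: sJ => _ _; apply.
by rewrite IJ => /(_ _ base_ring1) /=; rewrite mul1r.
Qed.

Lemma idealMV I : invertible I -> idealM I (idealV I) = base_ring.
Proof. by move=> [_ [J fJ IJ]]; rewrite -(inverse_idealV fJ IJ). Qed.

Lemma invertibleV I : invertible I -> invertible (idealV I).
Proof.
move=> [fI [J fJ IJ]]; rewrite -(inverse_idealV fJ IJ); split=> //.
by exists I => //; rewrite idealMC.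
Qed.

Lemma submodule_principal x : submodule (principal_ideal x).
Proof.
split; first by exists 0 => //; rewrite rmorph0 mul0r.
  by move=> _ _ [a _ <-] [b _ <-]; exists (a + b) => //; rewrite rmorphD mulrDl.
by move=> r _ [a _ <-]; exists (r * a) => //; rewrite rmorphM mulrA.
Qed.

Lemma principal_idealM x y :
  idealM (principal_ideal x) (principal_ideal y) = principal_ideal (x * y).
Proof.
rewrite eqEsubset; split.
  apply/idealM_sub => [|_ _ [a _ <-] [b _ <-]]; first exact: submodule_principal.
  by exists (a * b) => //; rewrite rmorphM mulrACA.
move=> _ [a _ <-]; rewrite mulrA; apply: mem_idealM; first by exists a.
by exists 1 => //; rewrite rmorph1 mul1r.
Qed.

Lemma principal_ideal1 : principal_ideal 1 = base_ring.
Proof.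
by rewrite eqEsubset; split=> _ [a _ <-]; exists a => //; rewrite mulr1.
Qed.

Lemma frac_repr x : x = (\n_(repr x))%:F / (\d_(repr x))%:F.
Proof.
rewrite -[in LHS](reprK x); move: (repr x) => u.
apply: (@mulIf _ (\d_u)%:F); first by rewrite tofrac_eq0 denom_ratioP.
rewrite divfK ?tofrac_eq0 ?denom_ratioP //.
rewrite -[in LHS](Ratio_numden u); unlock FracField.tofrac.
rewrite -[LHS]FracField.pi_mul /FracField.mulf.
apply/eqmodP; rewrite /= FracField.equivfE.
rewrite !numden_Ratio ?mulf_neq0 ?oner_eq0 ?denom_ratioP //.
by rewrite !mulr1 mulrC.
Qed.

Lemma fracP x : exists a b : R, b != 0 /\ x = a%:F / b%:F.
Proof.
exists \n_(repr x), \d_(repr x); split; first exact: denom_ratioP.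
exact: frac_repr.
Qed.

Lemma fractional_principal x : fractional (principal_ideal x).
Proof.
split; first exact: submodule_principal.
have [a [b [b0 ->]]] := fracP x; exists b => // _ [r _ <-].
exists (r * a) => //; rewrite rmorphM [RHS]mulrC -!mulrA mulVf ?mulr1 //.
by rewrite tofrac_eq0.
Qed.

Lemma invertible_principal x : x != 0 -> invertible (principal_ideal x).
Proof.
move=> x0; split; first exact: fractional_principal.
exists (principal_ideal x^-1); first exact: fractional_principal.
by rewrite principal_idealM mulfV // principal_ideal1.
Qed.

Lemma invertible_submodule I : invertible I -> submodule I.
Proof. by case=> [[]]. Qed.

Lemma invertible_neq0 I : invertible I -> exists2 x, I x & x != 0.
Proof.
move=> iI; apply: contrapT => h.
have I0 x : I x -> x = 0.
  by move=> Ix; apply/eqP/negPn/negP => x0; apply: h; exists x.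
have : idealM I (idealV I) `<=` [set 0].
  apply/idealM_sub => [|x y /I0-> _ /=]; last by rewrite mul0r.
  by split=> //= [x y -> ->|r x ->]; rewrite ?addr0 ?mulr0.
rewrite idealMV // => /(_ _ base_ring1) /eqP; rewrite oner_eq0 //.
Qed.

End FractionalIdeals.

Arguments base_ring : clear implicits.

(* As a zmodType this group is written additively: I + J is the product ideal *)
(* IJ, - I is the inverse ideal and 0 is R.                                   *)
Record inv_ideal (R : idomainType) :=
  InvIdeal { ideal_set :> set {fraction R};
             ideal_inv : `[< invertible ideal_set >] }.

HB.instance Definition _ R := [isSub for @ideal_set R].
HB.instance Definition _ R := [Choice of inv_ideal R by <:].

Section Picard.
Variable R : idomainType.
Implicit Types I J : inv_ideal R.

Lemma inv_idealP I : invertible I.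
Proof. exact/asboolP/ideal_inv. Qed.

Definition inv_ideal0 : inv_ideal R :=
  InvIdeal (asboolT (invertible_base_ring R)).
Definition inv_idealD I J : inv_ideal R :=
  InvIdeal (asboolT (invertibleM (inv_idealP I) (inv_idealP J))).
Definition inv_idealN I : inv_ideal R :=
  InvIdeal (asboolT (invertibleV (inv_idealP I))).

Lemma inv_idealDA : associative inv_idealD.
Proof. by move=> I J L; apply: val_inj; apply: idealMA. Qed.

Lemma inv_idealDC : commutative inv_idealD.
Proof. by move=> I J; apply: val_inj; apply: idealMC. Qed.

Lemma inv_ideal0D : left_id inv_ideal0 inv_idealD.
Proof.
by move=> I; apply/val_inj/ideal1M/invertible_submodule/inv_idealP.
Qed.

Lemma inv_idealND : left_inverse inv_ideal0 inv_idealN inv_idealD.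
Proof.
by move=> I; apply/val_inj; rewrite /= idealMC; apply/idealMV/inv_idealP.
Qed.

HB.instance Definition _ := GRing.isZmodule.Build (inv_ideal R)
  inv_idealDA inv_idealDC inv_ideal0D inv_idealND.

Definition principal_inv : {pred inv_ideal R} :=
  fun I => `[< exists2 x, x != 0 & (I : set _) = principal_ideal x >].

Lemma principal_zmod_closed : zmod_closed principal_inv.
Proof.
split; first by apply/asboolP; exists 1; rewrite ?oner_neq0 ?principal_ideal1.
move=> I J /asboolP[x x0 Ix] /asboolP[y y0 Jy]; apply/asboolP.
exists (x / y); first by rewrite mulf_neq0 ?invr_eq0.
rewrite -principal_idealM -Ix; congr idealM; apply/esym/inverse_idealV.
  exact: fractional_principal.
by rewrite Jy principal_idealM mulfV ?principal_ideal1.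
Qed.

HB.instance Definition _ :=
  GRing.isZmodClosed.Build (inv_ideal R) principal_inv principal_zmod_closed.

Definition Pic : Type := Quotient.quot principal_inv.
HB.instance Definition _ := GRing.Zmodule.on Pic.

Definition pic_class (I : inv_ideal R) : Pic := \pi_(Quotient.quot principal_inv) I.

Lemma pic_class_is_zmod_morphism : zmod_morphism pic_class.
Proof. by move=> I J; rewrite /pic_class raddfB. Qed.

HB.instance Definition _ := GRing.isZmodMorphism.Build (inv_ideal R) Pic
  pic_class pic_class_is_zmod_morphism.

Lemma pic_classP (c : Pic) : exists I, c = pic_class I.
Proof. by elim/quotW: c => I; exists I. Qed.

Lemma eq_pic_class I J : (pic_class I == pic_class J) = (I - J \in principal_inv).
Proof. by rewrite Quotient.idealrBE. Qed.

End Picard.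

#[short(type="domainAlgType")]
HB.structure Definition DomainAlgebra (D : idomainType) :=
  {R of GRing.ComUnitAlgebra D R & GRing.IntegralDomain R}.

HB.mixin Record hasRetraction (D : idomainType) R of DomainAlgebra D R := {
  retraction_subproof : inhabited {lrmorphism R -> D^o}
}.

#[short(type="retractAlgType")]
HB.structure Definition RetractAlgebra (D : idomainType) :=
  {R of hasRetraction D R & DomainAlgebra D R}.

Section RetractAlgebra.
Variables (D : idomainType) (R : retractAlgType D).

Lemma in_alg_inj : injective (in_alg R).
Proof.
have [e] := @retraction_subproof D R.
have eK d : e (in_alg R d) = d by rewrite /= linearZ rmorph1 /= [LHS]mulr1.
exact: can_inj eK.
Qed.

Lemma in_alg_eq0 d : (in_alg R d == 0) = (d == 0).
Proof. by rewrite -(inj_eq in_alg_inj) rmorph0. Qed.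

Lemma in_algF_neq0 d : d != 0 -> (in_alg R d)%:F != 0.
Proof. by rewrite tofrac_eq0 in_alg_eq0. Qed.

(* K inside Frac R; independent of the chosen representatives (frac_mapE)     *)
(* because D -> R is injective.                                               *)
Definition frac_map (x : {fraction D}) : {fraction R} :=
  (in_alg R \n_(repr x))%:F / (in_alg R \d_(repr x))%:F.

Lemma frac_mapE a b : b != 0 ->
  frac_map (a%:F / b%:F) = (in_alg R a)%:F / (in_alg R b)%:F.
Proof.
move=> b0; set x := _ / _; rewrite /frac_map.
have d0 : \d_(repr x) != 0 by exact: denom_ratioP.
have xE : x = (\n_(repr x))%:F / (\d_(repr x))%:F by exact: frac_repr.
apply/eqP; rewrite GRing.eqr_div ?in_algF_neq0 // -!tofracM -!rmorphM.
apply/eqP; congr (in_alg R _)%:F; apply/eqP; rewrite -tofrac_eq !tofracM.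
by rewrite -GRing.eqr_div ?tofrac_eq0 // -xE.
Qed.

Lemma frac_map_tofrac d : frac_map d%:F = (in_alg R d)%:F.
Proof.
rewrite -[d%:F]divr1 -tofrac1 frac_mapE ?oner_neq0 //.
by rewrite rmorph1 tofrac1 divr1.
Qed.

Lemma frac_map_is_zmod_morphism : zmod_morphism frac_map.
Proof.
move=> x y; have [a [b [b0 ->]]] := fracP x; have [c [d [d0 ->]]] := fracP y.
have bF : b%:F != 0 by rewrite tofrac_eq0.
have dF : d%:F != 0 by rewrite tofrac_eq0.
rewrite -mulNr addf_div // -!(tofracM, tofracN, tofracD).
rewrite !frac_mapE ?mulf_neq0 // -mulNr addf_div ?in_algF_neq0 //.
rewrite -!(tofracM, tofracN, tofracD).
by rewrite !(rmorphM, rmorphD, rmorphN).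
Qed.

HB.instance Definition _ := GRing.isZmodMorphism.Build {fraction D} {fraction R}
  frac_map frac_map_is_zmod_morphism.

Lemma frac_map_is_monoid_morphism : monoid_morphism frac_map.
Proof.
split; first by rewrite -tofrac1 frac_map_tofrac rmorph1 tofrac1.
move=> x y; have [a [b [b0 ->]]] := fracP x; have [c [d [d0 ->]]] := fracP y.
rewrite mulf_div -!tofracM !frac_mapE ?mulf_neq0 // mulf_div.
by rewrite -!tofracM !rmorphM.
Qed.

HB.instance Definition _ := GRing.isMonoidMorphism.Build
  {fraction D} {fraction R} frac_map frac_map_is_monoid_morphism.

Implicit Types (I J : set {fraction D}) (L : set {fraction R}).

(* IR, as a fractional ideal of R. *)
Definition extend I : set {fraction R} := Rspan (frac_map @` I).

Lemma extend_sub I L : submodule L ->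
  (extend I `<=` L) <-> (forall x, I x -> L (frac_map x)).
Proof.
move=> sL; rewrite /extend Rspan_sub //; split=> [h x Ix|h _ [x Ix <-]].
  by apply: h; exists x.
exact: h.
Qed.

Lemma submodule_extend I : submodule (extend I).
Proof. exact: submodule_Rspan. Qed.

Lemma mem_extend I x : I x -> extend I (frac_map x).
Proof. by move: x; apply/extend_sub => //; apply: submodule_extend. Qed.

Lemma submodule_preim L : submodule L -> submodule [set x | L (frac_map x)].
Proof.
move=> [L0 LD LZ]; split=> /=; first by rewrite rmorph0.
  by move=> x y Lx Ly; rewrite rmorphD; apply: LD.
by move=> r x Lx; rewrite rmorphM /= frac_map_tofrac; apply: LZ.
Qed.

Lemma extendM I J : extend (idealM I J) = idealM (extend I) (extend J).
Proof.
have sM := submodule_idealM; rewrite eqEsubset; split.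
  apply/extend_sub => //.
  apply/(idealM_sub _ _ (submodule_preim (sM _ _ _))) => x y Ix Jy /=.
  by rewrite rmorphM; apply: mem_idealM; apply: mem_extend.
have sE := @submodule_extend (idealM I J).
apply/idealM_sub => // u v Iu Jv.
move: u Iu; apply/(extend_sub _ (submodule_divr v sE)) => x Ix /=.
rewrite mulrC; move: v Jv.
apply/(extend_sub _ (submodule_divr (frac_map x) sE)) => y Jy /=.
by rewrite -rmorphM mulrC /=; exact: mem_extend (mem_idealM Ix Jy).
Qed.

Lemma extend_principal x :
  extend (principal_ideal x) = principal_ideal (frac_map x).
Proof.
rewrite eqEsubset; split.
  apply/extend_sub => [|_ [r _ <-]]; first exact: submodule_principal.
  by exists (in_alg R r) => //; rewrite rmorphM /= frac_map_tofrac.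
move=> _ [r _ <-]; have [_ _] := submodule_extend (principal_ideal x).
by apply; apply: mem_extend; exists 1 => //; rewrite tofrac1 mul1r.
Qed.

Lemma extend_base_ring : extend (base_ring D) = base_ring R.
Proof. by rewrite -!principal_ideal1 extend_principal rmorph1. Qed.

Lemma fractional_extend I : fractional I -> fractional (extend I).
Proof.
move=> [sI [d d0 hd]]; split; first exact: submodule_extend.
exists (in_alg R d); first by rewrite in_alg_eq0.
suff : extend I `<=` [set x | base_ring R (x * (in_alg R d)%:F)].
  by move=> h x /h /=; rewrite mulrC.
apply/extend_sub => [|x Ix /=]; first exact/submodule_divr/submodule_base_ring.
have [r _ rE] := hd _ Ix; exists (in_alg R r) => //.
by rewrite -!frac_map_tofrac rE rmorphM mulrC.
Qed.

Lemma invertible_extend I : invertible I -> invertible (extend I).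
Proof.
move=> [fI [J fJ IJ]]; split; first exact: fractional_extend.
exists (extend J); first exact: fractional_extend.
by rewrite -extendM IJ extend_base_ring.
Qed.

Definition extend_inv (I : inv_ideal D) : inv_ideal R :=
  InvIdeal (asboolT (invertible_extend (inv_idealP I))).

Lemma extend_inv_is_zmod_morphism : zmod_morphism extend_inv.
Proof.
have addE : {morph extend_inv : I J / I + J}.
  by move=> I J; apply/val_inj/extendM.
by move=> I J; apply: (addIr (extend_inv J)); rewrite subrK -addE subrK.
Qed.

HB.instance Definition _ := GRing.isZmodMorphism.Build
  (inv_ideal D) (inv_ideal R) extend_inv extend_inv_is_zmod_morphism.

Definition Pic_map (c : Pic D) : Pic R := pic_class (extend_inv (repr c)).

Lemma Pic_mapE (I : inv_ideal D) : Pic_map (pic_class I) = pic_class (extend_inv I).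
Proof.
apply/eqP; rewrite eq_pic_class -raddfB /=.
have : repr (pic_class I) - I \in @principal_inv D.
  by rewrite -eq_pic_class [pic_class (repr _)]reprK.
move=> /asboolP[x x0 xE]; apply/asboolP; exists (frac_map x).
  by rewrite fmorph_eq0.
by rewrite -extend_principal -xE.
Qed.

Lemma Pic_map_is_zmod_morphism : zmod_morphism Pic_map.
Proof.
move=> c d; have [I ->] := pic_classP c; have [J ->] := pic_classP d.
by rewrite -raddfB !Pic_mapE !raddfB.
Qed.

HB.instance Definition _ :=
  GRing.isZmodMorphism.Build (Pic D) (Pic R) Pic_map Pic_map_is_zmod_morphism.

Definition integral_ideal (I : inv_ideal R) : Prop := I `<=` base_ring R.

Definition unitary_ideal (I : inv_ideal R) : Prop :=
  exists2 x : {fraction D}, x != 0 & (I : set _) (frac_map x).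

Definition Picu_pred : {pred Pic R} := fun c =>
  c \in smallest (fun A : set (Pic R) => zmod_closed (mem A))
          [set pic_class I | I in [set I | integral_ideal I /\ unitary_ideal I]].

Lemma Picu_pred_zmod_closed : zmod_closed Picu_pred.
Proof.
split; first by apply/mem_set => A [[A0 _] _]; apply: set_mem A0.
move=> c d /set_mem cP /set_mem dP; apply/mem_set => A AP.
by have [[_ AB] _] := AP; apply/set_mem/AB; apply/mem_set; [apply: cP|apply: dP].
Qed.

HB.instance Definition _ :=
  GRing.isZmodClosed.Build (Pic R) Picu_pred Picu_pred_zmod_closed.

Lemma Pic_map_Picu c : Pic_map c \in Picu_pred.
Proof.
have [I ->] := pic_classP c; rewrite Pic_mapE; apply/mem_set => A [_]; apply.
have [[sI [d d0 hd]] _] := inv_idealP I.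
have [x Ix x0] := invertible_neq0 (inv_idealP I).
have dF : d%:F != 0 by rewrite tofrac_eq0.
pose P : inv_ideal D := InvIdeal (asboolT (invertible_principal dF)).
pose S : inv_ideal D := P + I.
have PI y : (I : set _) y -> (S : set _) (d%:F * y).
  by move=> Iy; apply: mem_idealM => //; exists 1; rewrite // tofrac1 mul1r.
exists (extend_inv S); first split.
- apply/extend_sub; first exact: submodule_base_ring.
  suff : (S : set _) `<=` [set y | base_ring R (frac_map y)] by apply.
  apply/idealM_sub; first exact/submodule_preim/submodule_base_ring.
  move=> _ y [r _ <-] /hd[s _ sE] /=; exists (in_alg R (r * s)) => //.
  by rewrite -frac_map_tofrac tofracM sE mulrA.
- exists (d%:F * x); first by rewrite mulf_neq0.
  exact: mem_extend (PI _ Ix).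
apply/eqP; rewrite eq_pic_class -raddfB addrK; apply/asboolP.
exists (frac_map d%:F); first by rewrite fmorph_eq0.
exact: extend_principal.
Qed.

End RetractAlgebra.

Record Picu (D : idomainType) (R : retractAlgType D) :=
  PicuElt { Picu_val :> Pic R; _ : Picu_val \in @Picu_pred D R }.

HB.instance Definition _ D R := [isSub for @Picu_val D R].
HB.instance Definition _ D R := [Choice of @Picu D R by <:].
HB.instance Definition _ D R := [SubChoice_isSubZmodule of @Picu D R by <:].

(* Pic_map with its codomain restricted to Picu R, by Pic_map_Picu. *)
Definition Picu_map (D : idomainType) (R : retractAlgType D) (c : Pic D) :
  Picu R := PicuElt (@Pic_map_Picu D R c).

Lemma Picu_map_is_zmod_morphism D (R : retractAlgType D) : zmod_morphism (@Picu_map D R).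
Proof. by move=> c d; apply: val_inj; rewrite /= !raddfB. Qed.

HB.instance Definition _ D (R : retractAlgType D) :=
  GRing.isZmodMorphism.Build (Pic D) (Picu R) (@Picu_map D R)
    (Picu_map_is_zmod_morphism R).

Definition image_pred (V W : zmodType) (f : {additive V -> W}) : {pred W} :=
  fun y => y \in range f.

Lemma image_pred_zmod_closed (V W : zmodType) (f : {additive V -> W}) :
  zmod_closed (image_pred f).
Proof.
split; first by apply/mem_set; exists 0; rewrite ?raddf0.
move=> _ _ /set_mem[x _ <-] /set_mem[y _ <-]; apply/mem_set.
by exists (x - y); rewrite ?raddfB.
Qed.

HB.instance Definition _ (V W : zmodType) (f : {additive V -> W}) :=
  GRing.isZmodClosed.Build W (image_pred f) (image_pred_zmod_closed f).

Definition direct_summand (V : zmodType) (A : zmodClosed V) : Prop :=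
  exists B : zmodClosed V,
    (forall x, exists a b, [/\ a \in A, b \in B & x = a + b]) /\
    (forall x, x \in A -> x \in B -> x = 0).

Definition zmod_isomorphic (V W : zmodType) : Prop :=
  exists f : {additive V -> W}, bijective f.

Definition LPic (D : idomainType) (R : retractAlgType D) : Type :=
  Quotient.quot (image_pred (@Pic_map D R)).
HB.instance Definition _ D R := GRing.Zmodule.on (@LPic D R).

Definition LPicu (D : idomainType) (R : retractAlgType D) : Type :=
  Quotient.quot (image_pred (@Picu_map D R)).
HB.instance Definition _ D R := GRing.Zmodule.on (@LPicu D R).

(* Main.v *)
From HB Require Import structures.
Require Import Defs.
From mathcomp Require Import all_boot all_algebra.
From mathcomp Require Import fraction boolp classical_sets.

(** An invertible ideal of R is isomorphic to an integral invertible ideal I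
    whose image eps(I) under the retraction eps : R -> D is nonzero; then eps(I)
    is invertible, and its class depends only on that of I. This defines a left
    inverse of iota, and a left inverse splits both inclusions. *)

Set Implicit Arguments.
Unset Strict Implicit.
Unset Printing Implicit Defensive.

Import GRing.Theory.
Local Open Scope ring_scope.

(** * Split injections of abelian groups *)

Definition ker_pred (V W : zmodType) (g : {additive W -> V}) : {pred W} :=
  fun y => g y == 0.

Lemma ker_pred_zmod_closed (V W : zmodType) (g : {additive W -> V}) :
  zmod_closed (ker_pred g).
Proof.
split; first by rewrite unfold_in /ker_pred raddf0.
by move=> x y; rewrite !unfold_in /ker_pred raddfB => /eqP-> /eqP->; rewrite subr0.
Qed.

HB.instance Definition _ (V W : zmodType) (g : {additive W -> V}) :=
  GRing.isZmodClosed.Build W (ker_pred g) (ker_pred_zmod_closed g).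

Section SplitInjection.
Variables (V W : zmodType) (f : {additive V -> W}) (g : {additive W -> V}).
Hypothesis fK : cancel f g.

Lemma mem_image_pred v : f v \in image_pred f.
Proof. by apply/mem_set; exists v. Qed.

(** The complement is the kernel of [g]: the two summands of [x] are [f (g x)] and [x - f (g x)]. *)
Lemma direct_summand_image : direct_summand (image_pred f).
Proof.
exists (ker_pred g : zmodClosed W); split=> [x|x /set_mem[v _ <-]].
  exists (f (g x)), (x - f (g x)); split; first exact: mem_image_pred.
    by rewrite unfold_in /ker_pred raddfB fK subrr.
  by rewrite addrC subrK.
by rewrite unfold_in /ker_pred fK => /eqP->; rewrite raddf0.
Qed.

Local Notation cokernel := (Quotient.quot (image_pred f)).

Definition split_map (w : W) : V * cokernel := (g w, (\pi_cokernel w)%qT).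

Lemma split_map_is_zmod_morphism : zmod_morphism split_map.
Proof. by move=> x y; rewrite /split_map !raddfB. Qed.

HB.instance Definition _ := GRing.isZmodMorphism.Build W (V * cokernel)%type
  split_map split_map_is_zmod_morphism.

Lemma split_isomorphic : zmod_isomorphic W (V * cokernel)%type.
Proof.
exists split_map.
(* The inverse projects a representative onto the kernel of [g] along the image of [f]. The result
   does not depend on the representative, and adding [f v] then sets the first coordinate to [v]. *)
exists (fun p => f p.1 + (repr p.2 - f (g (repr p.2)))) => [w|[v q]] /=.
  have : repr (\pi_cokernel w)%qT - w \in image_pred f.
    by rewrite Quotient.idealrBE reprK.
  move=> /set_mem[v _]; move: (repr _) => w' /eqP; rewrite eq_sym subr_eq => /eqP->.
  by rewrite !raddfD /= fK [X in _ + X]addrACA subrr add0r addrCA subrr addr0.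
rewrite /split_map raddfD raddfB /= !fK subrr addr0; congr (_, _).
rewrite -[RHS]reprK; apply/eqP; rewrite -Quotient.idealrBE.
by rewrite addrCA addrAC subrr add0r -raddfB mem_image_pred.
Qed.

End SplitInjection.

(** * Invertible ideals and their integral representatives *)

Section InvertibleIdeals.
Local Open Scope classical_set_scope.
Variable R : idomainType.
Implicit Types (I J : set {fraction R}) (A : inv_ideal R).

Lemma fractional_integral I : submodule I -> I `<=` base_ring R -> fractional I.
Proof.
by move=> sI IR; split=> //; exists 1; rewrite ?oner_neq0 // => x /IR; rewrite tofrac1 mul1r.
Qed.

(** The inverse of I is x^-1 J. This is how an image under [eps] is shown to be invertible. *)
Lemma invertible_factor I J x : fractional I -> fractional J -> x != 0 ->
  idealM I J = principal_ideal x -> invertible I.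
Proof.
move=> fI fJ x0 IJ; split=> //; exists (idealM J (principal_ideal x^-1)).
  exact/fractionalM/fractional_principal.
by rewrite idealMA IJ principal_idealM mulfV // principal_ideal1.
Qed.

Lemma principal_idealM_sub I J x : submodule J ->
  (forall y, I y -> J (x * y)) -> idealM (principal_ideal x) I `<=` J.
Proof.
move=> sJ IJ; apply/idealM_sub => // _ y [r _ <-] Iy; rewrite -mulrA.
by case: sJ => _ _; apply; apply: IJ.
Qed.

Definition inv_principal x (x0 : x != 0) : inv_ideal R :=
  InvIdeal (asboolT (invertible_principal x0)).

Lemma pic_class_principal A x : x != 0 -> (A : set _) = principal_ideal x ->
  pic_class A = 0.
Proof.
move=> x0 Ax; apply/eqP; rewrite -(raddf0 (@pic_class R)) eq_pic_class subr0.
by apply/asboolP; exists x.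
Qed.

Lemma pic_class_scale A x (x0 : x != 0) :
  pic_class (inv_principal x0 + A) = pic_class A.
Proof.
rewrite raddfD -[RHS]add0r; congr (_ + _); exact: (pic_class_principal x0).
Qed.

(** Multiplication by a common denominator of A does not change the class. *)
Lemma integral_representative A :
  exists2 B : inv_ideal R, (B : set _) `<=` base_ring R & pic_class B = pic_class A.
Proof.
have [[sA [d d0 hd]] _] := inv_idealP A.
have dF : d%:F != 0 by rewrite tofrac_eq0.
exists (inv_principal dF + A); last exact: pic_class_scale.
exact: principal_idealM_sub (submodule_base_ring R) hd.
Qed.

End InvertibleIdeals.

(** * Images of ideals under the retraction *)

Section Specialization.
Local Open Scope classical_set_scope.
Variables (D : idomainType) (R : retractAlgType D) (eps : {rmorphism R -> D}).
Hypothesis epsK : cancel (in_alg R) eps.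
Implicit Types (I J : set {fraction R}).

(* This is eps(I) when I is contained in R. *)
Definition specialize I : set {fraction D} :=
  [set (eps r)%:F | r in [set r | I r%:F]].

Lemma specialize_base_ring I : specialize I `<=` base_ring D.
Proof. by move=> _ [r _ <-]; exists (eps r). Qed.

Lemma submodule_specialize I : submodule I -> submodule (specialize I).
Proof.
move=> [I0 ID IZ]; split; first by exists 0; rewrite /= ?rmorph0 ?tofrac0.
  move=> _ _ [r Ir <-] [s Is <-]; exists (r + s); last by rewrite rmorphD tofracD.
  by rewrite /= tofracD; apply: ID.
move=> d _ [r Ir <-]; exists (in_alg R d * r); last by rewrite rmorphM epsK tofracM.
by rewrite /= tofracM; apply: IZ.
Qed.

Lemma fractional_specialize I : submodule I -> fractional (specialize I).
Proof.
move=> sI; apply: fractional_integral; first exact: submodule_specialize.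
exact: specialize_base_ring.
Qed.

(** As [eps] need not extend to [{fraction R}], the preimage of L is taken inside R. Inclusion in it
    says both that an ideal is integral and that its image lies in L, and can be tested on
    generators. *)
Lemma submodule_specialize_preim (L : set {fraction D}) : submodule L ->
  submodule [set r%:F | r in [set r | L (eps r)%:F]].
Proof.
move=> [L0 LD LZ]; split; first by exists 0; rewrite /= ?rmorph0 ?tofrac0.
  move=> _ _ [r Lr <-] [s Ls <-]; exists (r + s); last by rewrite tofracD.
  by rewrite /= rmorphD tofracD; apply: LD.
move=> t _ [r Lr <-]; exists (t * r); last by rewrite tofracM.
by rewrite /= rmorphM tofracM; apply: LZ.
Qed.

Lemma specialize_sub I (L : set {fraction D}) :
  I `<=` [set r%:F | r in [set r | L (eps r)%:F]] -> specialize I `<=` L.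
Proof.
move=> IL _ [r Ir <-]; have [s Ls /eqP] := IL _ Ir.
by rewrite tofrac_eq => /eqP <-.
Qed.

(** Integrality puts both factors of each generator x y in R, where [eps] is multiplicative. *)
Lemma specializeM I J : submodule I -> submodule J ->
  I `<=` base_ring R -> J `<=` base_ring R ->
  specialize (idealM I J) = idealM (specialize I) (specialize J).
Proof.
move=> sI sJ IR JR; rewrite eqEsubset; split.
  apply: specialize_sub; apply/idealM_sub => [|x y Ix Jy].
    exact/submodule_specialize_preim/submodule_idealM.
  have [r _ rx] := IR _ Ix; have [s _ sy] := JR _ Jy.
  exists (r * s); last by rewrite tofracM rx sy.
  rewrite /= rmorphM tofracM; apply: mem_idealM.
    by exists r; rewrite /= ?rx.
  by exists s; rewrite /= ?sy.
apply/idealM_sub; first exact/submodule_specialize/submodule_idealM.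
move=> _ _ [r Ir <-] [s Js <-]; exists (r * s); last by rewrite rmorphM tofracM.
by rewrite /= tofracM; apply: mem_idealM.
Qed.

Lemma specialize_principal r :
  specialize (principal_ideal r%:F) = principal_ideal (eps r)%:F.
Proof.
rewrite eqEsubset; split.
  apply: specialize_sub => _ [s _ <-]; exists (s * r); rewrite ?tofracM //=.
  by exists (eps s) => //; rewrite rmorphM tofracM.
move=> _ [d _ <-]; exists (in_alg R d * r); last by rewrite rmorphM epsK tofracM.
by exists (in_alg R d) => //; rewrite tofracM.
Qed.

Lemma specialize_extend (J : set {fraction D}) : submodule J ->
  J `<=` base_ring D -> specialize (extend J) = J.
Proof.
move=> sJ JD; rewrite eqEsubset; split.
  apply: specialize_sub; apply/extend_sub; first exact: submodule_specialize_preim.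
  move=> x Jx; have [d _ dx] := JD _ Jx; exists (in_alg R d).
    by rewrite /= epsK dx.
  by rewrite -frac_map_tofrac dx.
move=> x Jx; have [d _ dx] := JD _ Jx; exists (in_alg R d); last by rewrite epsK.
by rewrite /= -frac_map_tofrac dx; apply: mem_extend.
Qed.

(** Otherwise all generators of I I^-1 = R would lie in the kernel of [eps], against [eps 1 = 1]. *)
Lemma exists_eps_neq0 I : invertible I ->
  exists a b r, [/\ I a, idealV I b, a * b = r%:F & eps r != 0].
Proof.
move=> iI; apply: contrapT => h.
(* For L = 0 the preimage of L is the kernel of [eps]. *)
have : idealM I (idealV I) `<=` [set r%:F | r in [set r | [set 0] (eps r)%:F]].
  apply/idealM_sub => [|a b Ia Ib].
    apply: submodule_specialize_preim; split=> //= [x y -> ->|r x ->].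
      by rewrite addr0.
    by rewrite mulr0.
  have [r _ rE] := Ib _ Ia; exists r; last by rewrite rE mulrC.
  apply/eqP; rewrite tofrac_eq0; apply/negPn/negP => r0; apply: h.
  by exists a, b, r; split; rewrite // rE mulrC.
rewrite idealMV // => /(_ _ (base_ring1 R))[r /= /eqP].
rewrite tofrac_eq0 => /eqP r0 /eqP; rewrite -tofrac1 tofrac_eq => /eqP r1.
by move: r0; rewrite r1 rmorph1 => /eqP; rewrite oner_eq0.
Qed.

(** A relation, because eps(I) varies with the integral representative I of [c] and may be zero for
    some of them. *)
Definition specializes (c : Pic R) (d : Pic D) : Prop :=
  exists (I : inv_ideal R) (J : inv_ideal D),
    [/\ (I : set _) `<=` base_ring R, (J : set _) = specialize I,
        pic_class I = c & pic_class J = d].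

Lemma specializes_total c : exists d, specializes c d.
Proof.
have [I ->] := pic_classP c; have iI := inv_idealP I.
have [a [b [r [Ia Vb abE r0]]]] := exists_eps_neq0 iI.
have ab0 : a * b != 0.
  by rewrite abE tofrac_eq0; apply: contraNneq r0 => ->; rewrite rmorph0.
move: (ab0); rewrite mulf_eq0 negb_or => /andP[a0 b0].
have sR := submodule_base_ring R.
(* These are b I and a I^-1, integral since b is in I^-1 and a is in I. Their product is r R, so
   their images multiply to the nonzero principal ideal eps(r) D and eps(b I) is invertible. *)
set I' := inv_principal b0 + I; set K' := inv_principal a0 - I.
have I'R : (I' : set _) `<=` base_ring R.
  exact: principal_idealM_sub.
have K'R : (K' : set _) `<=` base_ring R.
  by apply: principal_idealM_sub => // y Vy; rewrite mulrC; apply: Vy.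
have [sI' sK'] : submodule I' /\ submodule K'.
  by split; apply/invertible_submodule/inv_idealP.
have I'K' : idealM I' K' = principal_ideal r%:F.
  have : I' + K' = inv_principal ab0.
    rewrite /I' /K' addrACA subrr addr0; apply: val_inj => /=.
    by rewrite principal_idealM mulrC.
  by move=> /(congr1 val) /=; rewrite abE.
have iJ : invertible (specialize I').
  have fS := fractional_specialize.
  apply: (@invertible_factor _ _ (specialize K') (eps r)%:F); rewrite ?tofrac_eq0 //.
  - exact: fS.
  - exact: fS.
  by rewrite -specializeM // I'K' specialize_principal.
exists (pic_class (InvIdeal (asboolT iJ))), I', (InvIdeal (asboolT iJ)).
by split; rewrite ?pic_class_scale.
Qed.

Lemma specializesD c c' d d' :
  specializes c d -> specializes c' d' -> specializes (c + c') (d + d').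
Proof.
move=> [I [J [IR JE <- <-]]] [I' [J' [IR' JE' <- <-]]].
exists (I + I'), (J + J'); split; rewrite ?raddfD //.
  apply/idealM_sub => [|x y /IR[r _ <-] /IR'[s _ <-]].
    exact: submodule_base_ring.
  by exists (r * s); rewrite ?tofracM.
rewrite specializeM //; try exact/invertible_submodule/inv_idealP.
by rewrite -JE -JE'.
Qed.

Lemma specializes0 d : specializes 0 d -> d = 0.
Proof.
move=> [I [J [IR JE I0 <-]]].
move/eqP: I0; rewrite -(raddf0 (@pic_class R)) eq_pic_class subr0.
move=> /asboolP[x x0 Ix].
have [r _ rx] : base_ring R x.
  by apply: IR; rewrite Ix; exists 1; rewrite // tofrac1 mul1r.
have Jr : (J : set _) = principal_ideal (eps r)%:F.
  by rewrite JE Ix -rx specialize_principal.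
(* The generator [eps r] is nonzero because J, being invertible, is not the zero ideal. *)
apply: (pic_class_principal _ Jr); apply/eqP => r0.
have [y] := invertible_neq0 (inv_idealP J).
by rewrite Jr r0 => -[t _ <-]; rewrite mulr0 eqxx.
Qed.

(** If e is a value at -c, then d + e and d' + e are both values at 0, hence both zero. *)
Lemma specializes_fun c d d' : specializes c d -> specializes c d' -> d = d'.
Proof.
move=> cd cd'; have [e ce] := specializes_total (- c).
have := specializesD cd ce; have := specializesD cd' ce; rewrite subrr.
by move=> /specializes0 d'e /specializes0; rewrite -d'e => /addIr.
Qed.

(** For an integral representative J of [d], the extension J R is integral and [eps] maps it back
    onto J. *)
Lemma specializes_Pic_map d : specializes (Pic_map R d) d.
Proof.
have [A ->] := pic_classP d; have [J JD <-] := integral_representative A.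
have sJ := invertible_submodule (inv_idealP J).
exists (extend_inv R J), J; rewrite Pic_mapE; split=> //; last first.
  by rewrite specialize_extend.
apply/extend_sub => [|x /JD[t _ <-]]; first exact: submodule_base_ring.
by rewrite frac_map_tofrac; exists (in_alg R t).
Qed.

(** Choice extracts a function from the relation; single-valuedness makes it additive and a left
    inverse. *)
Lemma specialization_retraction :
  exists g : {additive Pic R -> Pic D}, cancel (@Pic_map D R) g.
Proof.
have [g gP] := choice specializes_total.
have gD : zmod_morphism g.
  have addE : {morph g : c c' / c + c'}.
    by move=> c c'; apply: specializes_fun (gP _) (specializesD (gP _) (gP _)).
  by move=> c c'; apply: (addIr (g c')); rewrite subrK -addE subrK.
pose gM := GRing.isZmodMorphism.Build _ _ g gD.
pose G : {additive Pic R -> Pic D} := HB.pack g gM.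
exists G => d; exact: specializes_fun (gP _) (specializes_Pic_map d).
Qed.

End Specialization.

(** * Splitting the Picard groups *)

Lemma Pic_map_split (D : idomainType) (R : retractAlgType D) :
  exists g : {additive Pic R -> Pic D}, cancel (@Pic_map D R) g.
Proof.
have [e] := @retraction_subproof D R.
apply: (@specialization_retraction D R (e : {rmorphism R -> D})) => d.
by rewrite /= linearZ rmorph1 /= [LHS]mulr1.
Qed.

Theorem proposition6p6 (D : idomainType) (R : retractAlgType D)
    (D_not_field : ~ GRing.field_axiom D) :
  [/\ injective (@Pic_map D R),
      direct_summand (image_pred (@Pic_map D R)) /\
      direct_summand (image_pred (@Picu_map D R)),
      zmod_isomorphic (Pic R) (Pic D * LPic R)%type
    & zmod_isomorphic (Picu R) (Pic D * LPicu R)%type].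
Proof.
have [g gK] := Pic_map_split R.
(* The restriction of [g] still inverts on the left, since [Picu_map] takes the values of
   [Pic_map]. *)
pose gu : {additive Picu R -> Pic D} := g \o (val : Picu R -> Pic R).
have guK : cancel (@Picu_map D R) gu by move=> c; apply: gK.
split; first exact: can_inj gK.
- by split; [exact: direct_summand_image gK | exact: direct_summand_image guK].
- exact: split_isomorphic gK.
- exact: split_isomorphic guK.
Qed.
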